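(* Suppose $b>1$. For fixed demands and parameters as described in the context, and a given $\alpha\in(0,1)$, let $\beta^{\mathrm{SO}}$ be the (unique) minimizer of $\mathrm{PHT}$ over $[0,1]$. Then: 1. If $\displaystyle \omega\,\frac{\alpha}{1-\alpha}\left(\frac{x^{rs}}{o^p}+f_b\right)>\left(\frac{b+1}{\frac{b}{o^p}+1}\right)^{\frac1b}x^{pv}$, then $\beta^{\mathrm{SO}}<1$. 2. If $\displaystyle \omega\,\frac{\alpha}{1-\alpha}\,f_b\ \ge\ \left(\frac{b+1}{\frac{b}{o^p}+1}\right)^{\frac1b}\left(x^{pv}+x^{rs}\right)$, then $\beta^{\mathrm{SO}}=0$. Moreover, for fixed demands and parameters, there exists $\underline{\alpha}>0$ such that $\beta^{\mathrm{SO}}=1$ for all $\alpha\in(0,1)$ with $\alpha<\underline{\alpha}$.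
   Context: Parameters: $t_f>0$, $C>0$, $a>0$, $b>0$, $o^p>1$ (pool occupancy), $\Delta_p>1$, $\Delta_b>1$ (detour factors), $\gamma>0$. Demands: private vehicles $x^{pv}>0$, ride-hailing $x^{rs}>0$, bus users $x^b>0$, and bus flow $f_b>0$ with $f_b<x^b$. The constant $\omega=\omega(n_e)\in(0,1]$ is fixed (capacity reduction due to a fixed number $n_e\ge 0$ of empty vehicles; it does not depend on $\alpha$). The constant $k=k(f_b)$ is the value at $f_b$ of a continuously differentiable function $k:[0,\infty)\to(0,\infty)$ with $k'>0$ and $k(0)>1$; in particular $k>1$. The space split is $\alpha\in(0,1)$: a fraction $\alpha$ goes to the vehicle network and $1-\alpha$ to the bus network. Delay functions, for solo demand $x^s\ge 0$ and pool demand $x^p\ge 0$: $$t_{\mathcal V}(x^s)=t_f\left(1+a\left(\frac{x^{pv}+x^s}{\omega\alpha C}\right)^b\right),\qquad t_{\mathcal B}(x^p)=t_f\left(1+a\left(\frac{\frac{x^p}{o^p}+f_b}{(1-\alpha)C}\right)^b\right)\Delta_p k,$$ $$t_b(x^p)=t_f\left(1+a\left(\frac{\frac{x^p}{o^p}+f_b}{(1-\alpha)C}\right)^b\right)\Delta_b k+\gamma .$$ For $\beta\in[0,1]$ (the fraction of ride-hailing users who pool), the total passenger hours travelled are $$\mathrm{PHT}(\beta)=x^{pv}t_{\mathcal V}((1-\beta)x^{rs})+(1-\beta)x^{rs}t_{\mathcal V}((1-\beta)x^{rs})+\beta x^{rs}t_{\mathcal B}(\beta x^{rs})+x^b t_b(\beta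 x^{rs}),$$ and the system optimum is $\beta^{\mathrm{SO}}\in\operatorname*{arg\,min}_{\beta\in[0,1]}\mathrm{PHT}(\beta)$, which is unique when $b>1$. *)

(* Defs.v *)
(* Standard-library real numbers. *)
From Stdlib Require Import Reals.
Open Scope R_scope.

(* Fixed demands and parameters; the space split alpha is deliberately not part
   of this record, so that nothing in it can depend on alpha. *)
Record scenario := Scenario {
  t_f : R;                (* free-flow travel time *)
  Cap : R;                (* total capacity C *)
  bpr_a : R;              (* coefficient a of the delay function *)
  bpr_b : R;              (* exponent b of the delay function *)
  o_p : R;                (* occupancy of pooled vehicles *)
  Delta_p : R;            (* detour factor of pooled trips *)
  Delta_b : R;            (* detour factor of bus trips *)
  gamma : R;
  x_pv : R;               (* private-vehicle demand *)
  x_rs : R;               (* ride-hailing demand *)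
  x_b : R;                (* bus-user demand *)
  f_b : R;                (* bus flow *)
  n_e : R;                (* number of empty vehicles *)
  omega_fun : R -> R;     (* capacity reduction as a function of n_e *)
  k_fun : R -> R;         (* only its restriction to [0, +oo) is meaningful *)
  t_f_gt0 : 0 < t_f;
  Cap_gt0 : 0 < Cap;
  bpr_a_gt0 : 0 < bpr_a;
  bpr_b_gt0 : 0 < bpr_b;
  o_p_gt1 : 1 < o_p;
  Delta_p_gt1 : 1 < Delta_p;
  Delta_b_gt1 : 1 < Delta_b;
  gamma_gt0 : 0 < gamma;
  x_pv_gt0 : 0 < x_pv;
  x_rs_gt0 : 0 < x_rs;
  x_b_gt0 : 0 < x_b;
  f_b_gt0 : 0 < f_b;
  f_b_lt_x_b : f_b < x_b;
  n_e_ge0 : 0 <= n_e;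
  omega_range : 0 < omega_fun n_e <= 1;
  k_fun_gt0 : forall x, 0 <= x -> 0 < k_fun x;
  (* D_in and continue_in are relative to [0, +oo): one-sided at 0. *)
  k_fun_C1 : exists dk : R -> R, forall x, 0 <= x ->
    D_in k_fun dk (fun y => 0 <= y) x /\
    continue_in dk (fun y => 0 <= y) x /\
    0 < dk x;
  k_fun0_gt1 : 1 < k_fun 0
}.

Definition omega (S : scenario) : R := omega_fun S (n_e S).

Definition k (S : scenario) : R := k_fun S (f_b S).

(* Rpower u v is the usual power for u > 0 only.  For demands >= 0 and
   0 < alpha < 1 all bases below are positive, since x_pv > 0 and f_b > 0. *)
Definition t_V (S : scenario) (alpha xs : R) : R :=
  t_f S *
  (1 + bpr_a S * Rpower ((x_pv S + xs) / (omega S * alpha * Cap S)) (bpr_b S)).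

Definition t_B (S : scenario) (alpha xp : R) : R :=
  t_f S *
  (1 + bpr_a S *
       Rpower ((xp / o_p S + f_b S) / ((1 - alpha) * Cap S)) (bpr_b S)) *
  Delta_p S * k S.

Definition t_b (S : scenario) (alpha xp : R) : R :=
  t_f S *
  (1 + bpr_a S *
       Rpower ((xp / o_p S + f_b S) / ((1 - alpha) * Cap S)) (bpr_b S)) *
  Delta_b S * k S + gamma S.

(* Total passenger hours travelled when a fraction beta of ride-hailing users
   pool. *)
Definition PHT (S : scenario) (alpha beta : R) : R :=
  x_pv S * t_V S alpha ((1 - beta) * x_rs S) +
  (1 - beta) * x_rs S * t_V S alpha ((1 - beta) * x_rs S) +
  beta * x_rs S * t_B S alpha (beta * x_rs S) +
  x_b S * t_b S alpha (beta * x_rs S).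

(* beta belongs to the argmin of PHT over [0, 1]. *)
Definition system_optimum (S : scenario) (alpha beta : R) : Prop :=
  0 <= beta <= 1 /\
  forall beta', 0 <= beta' <= 1 -> PHT S alpha beta <= PHT S alpha beta'.

(* Main.v *)
Require Import Defs.
From Stdlib Require Import Reals Lra.
From Coquelicot Require Import Coquelicot.
Open Scope R_scope.

(** The derivative of [PHT] is [x_rs * t_f] times a marginal cost that is
    strictly increasing in [beta], so [PHT] is strictly convex, and the sign of
    the marginal cost at an endpoint of [[0, 1]] locates the minimizer.  Write
    [u] and [v] for the load ratios of the bus and vehicle networks.  Since
    [k > 1], [Delta_p > 1], [Delta_b > 1] and [x_b > f_b], the marginal cost is
    positive as soon as [(b / o_p + 1) u^b >= (b + 1) v^b], and both conditions
    say exactly this, at [beta = 1] and at [beta = 0].  When [alpha] tends to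
    0, [v] tends to infinity while [u] stays bounded, so the marginal cost at
    [beta = 1] becomes negative. *)

(** * Minimizers on the unit interval of a function with increasing derivative *)

Section StrictlyConvex.

Variables F dF : R -> R.
Hypothesis F_deriv : forall x, 0 <= x <= 1 -> derivable_pt_lim F x (dF x).
Hypothesis dF_incr :
  forall x y, 0 <= x -> x < y -> y <= 1 -> dF x < dF y.

Lemma MVT_unit (x y : R) : 0 <= x -> x < y -> y <= 1 ->
  exists c, F y - F x = dF c * (y - x) /\ x < c < y.
Proof.
  intros hx hxy hy; apply (MVT_cor2 F dF x y hxy).
  intros c hc; apply F_deriv; lra.
Qed.

(** Compare the mean slopes on the two halves of the interval between two minimizers: minimality
    makes the left slope nonnegative and the right one nonpositive, while [dF_incr] makes the left
    one strictly smaller. *)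
Lemma incr_deriv_minimizer_unique (x y : R) :
  0 <= x <= 1 -> 0 <= y <= 1 ->
  (forall z, 0 <= z <= 1 -> F x <= F z) ->
  (forall z, 0 <= z <= 1 -> F y <= F z) -> x = y.
Proof.
  assert (aux : forall x y, 0 <= x -> x < y -> y <= 1 ->
    (forall z, 0 <= z <= 1 -> F x <= F z) ->
    (forall z, 0 <= z <= 1 -> F y <= F z) -> False).
  { clear x y; intros x y hx hxy hy mx my.
    destruct (MVT_unit x ((x + y) / 2)) as [c [ec hc]]; try lra.
    destruct (MVT_unit ((x + y) / 2) y) as [d [ed hd]]; try lra.
    assert (hm : 0 <= (x + y) / 2 <= 1) by lra.
    specialize (mx _ hm); specialize (my _ hm).
    assert (hcd : dF c < dF d) by (apply dF_incr; lra).
    destruct (Rlt_or_le (dF c) 0) as [n | p]; nra. }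
  intros hx hy mx my.
  destruct (Rtotal_order x y) as [l | [e | l]]; [exfalso | exact e | exfalso].
  - apply (aux x y); tauto || lra.
  - apply (aux y x); tauto || lra.
Qed.

Lemma deriv_minimizer_exists :
  exists x, 0 <= x <= 1 /\ forall z, 0 <= z <= 1 -> F x <= F z.
Proof.
  destruct (continuity_ab_min F 0 1) as [x [hm hx]]; [lra | | eauto].
  intros c hc; apply derivable_continuous_pt.
  exists (dF c); exact (F_deriv c hc).
Qed.

Lemma incr_deriv_min_at_0 (x : R) :
  0 <= dF 0 -> 0 <= x <= 1 -> (forall z, 0 <= z <= 1 -> F x <= F z) -> x = 0.
Proof.
  intros h0 hx hm; destruct (Req_dec x 0) as [e | ne]; [exact e | exfalso].
  destruct (MVT_unit 0 x) as [c [ec hc]]; try lra.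
  assert (dF 0 < dF c) by (apply dF_incr; lra).
  assert (F x <= F 0) by (apply hm; lra).
  nra.
Qed.

Lemma incr_deriv_min_at_1 (x : R) :
  dF 1 <= 0 -> 0 <= x <= 1 -> (forall z, 0 <= z <= 1 -> F x <= F z) -> x = 1.
Proof.
  intros h1 hx hm; destruct (Req_dec x 1) as [e | ne]; [exact e | exfalso].
  destruct (MVT_unit x 1) as [c [ec hc]]; try lra.
  assert (dF c < dF 1) by (apply dF_incr; lra).
  assert (F x <= F 1) by (apply hm; lra).
  nra.
Qed.

(** A short step to the left of 1 lowers [F], so the sign of the derivative at 1 settles the
    matter. *)
Lemma pos_deriv_not_min_at_1 (x : R) :
  0 < dF 1 -> 0 <= x <= 1 -> (forall z, 0 <= z <= 1 -> F x <= F z) -> x < 1.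
Proof.
  intros h1 hx hm; destruct (Rlt_or_le x 1) as [l | g]; [exact l | exfalso].
  replace x with 1 in hm by lra.
  (* Taking [dF 1] itself as the tolerance forces nearby difference quotients to be positive. *)
  destruct (F_deriv 1 ltac:(lra) (dF 1) h1) as [[d hd] H]; simpl in H.
  set (h := Rmin (d / 2) 1).
  assert (hh : 0 < h <= 1 /\ h < d).
  { unfold h, Rmin; destruct (Rle_dec (d / 2) 1); lra. }
  specialize (H (- h) ltac:(lra)).
  rewrite Rabs_Ropp, (Rabs_pos_eq h) in H by lra.
  specialize (H ltac:(lra)); apply Rabs_def2 in H.
  specialize (hm (1 + - h) ltac:(lra)).
  assert (q : (F (1 + - h) - F 1) / - h <= 0).
  { apply Rmult_le_reg_r with h; [lra |].
    replace ((F (1 + - h) - F 1) / - h * h)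
      with (- (F (1 + - h) - F 1)) by (field; lra).
    lra. }
  lra.
Qed.

End StrictlyConvex.

(* The relative derivative at 0 is one-sided, so the mean value theorem is
   applied to [fun x => g (Rabs x)], which is continuous at 0. *)
Lemma D_in_pos_increasing (g dg : R -> R) (x : R) :
  (forall y, 0 <= y -> D_in g dg (fun z => 0 <= z) y /\ 0 < dg y) ->
  0 < x -> g 0 < g x.
Proof.
  intros H hx.
  assert (cont : forall y, 0 <= y -> continuity_pt (fun z => g (Rabs z)) y).
  { intros y hy eps heps.
    destruct (cont_deriv _ _ _ _ (proj1 (H y hy)) eps heps) as [d [hd Hd]].
    exists d; split; [exact hd |].
    intros z [_ hz]; rewrite (Rabs_pos_eq y hy).
    assert (hyz : Rabs (Rabs z - y) < d).
    { rewrite <- (Rabs_pos_eq y hy).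
      eapply Rle_lt_trans; [apply Rabs_triang_inv2 | exact hz]. }
    (* The relative limit ignores the point [y] itself, so this case is separate. *)
    destruct (Req_dec y (Rabs z)) as [e | ne].
    - rewrite <- e; unfold dist; simpl; rewrite Rdist_eq; exact heps.
    - apply Hd; repeat split; [apply Rabs_pos | exact ne | exact hyz]. }
  destruct (MVT_gen (fun z => g (Rabs z)) 0 x dg) as [c [hc e]].
  - rewrite Rmin_left, Rmax_right by lra; intros y hy.
    apply is_derive_Reals; intros eps heps.
    destruct (proj1 (H y ltac:(lra)) eps heps) as [d [hd Hd]].
    (* The bound by [y] keeps [y + h] positive, hence inside the domain of the relative derivative
       and unaffected by [Rabs]. *)
    assert (hm : 0 < Rmin d y) by (apply Rmin_pos; lra).
    exists (mkposreal _ hm); simpl; intros h hn hh.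
    assert (h1 := Rmin_l d y); assert (h2 := Rmin_r d y).
    assert (hb : - y < h < y) by (apply Rabs_def2 in hh; lra).
    specialize (Hd (y + h)); unfold dist in Hd; simpl in Hd; unfold Rdist in Hd.
    rewrite (Rabs_pos_eq (y + h)), (Rabs_pos_eq y) by lra.
    replace (y + h - y) with h in Hd by ring.
    apply Hd; repeat split; lra.
  - rewrite Rmin_left, Rmax_right by lra; intros y hy; apply cont; lra.
  - rewrite Rmin_left, Rmax_right in hc by lra.
    rewrite Rabs_R0, (Rabs_pos_eq x) in e by lra.
    destruct (H c ltac:(lra)) as [_ hp]; nra.
Qed.

Lemma k_gt1 (S : scenario) : 1 < k S.
Proof.
  destruct (k_fun_C1 S) as [dk H].
  apply Rlt_trans with (k_fun S 0); [apply k_fun0_gt1 |].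
  apply D_in_pos_increasing with dk; [| apply f_b_gt0].
  intros y hy; destruct (H y hy) as [h1 [_ h2]]; tauto.
Qed.

(** * Real powers *)

Lemma Rpower_gt0 (x y : R) : 0 < Rpower x y.
Proof. apply exp_pos. Qed.

Lemma Rpower_pred (x y : R) : 0 < x -> Rpower x y = x * Rpower x (y - 1).
Proof.
  intros hx; rewrite <- (Rpower_1 x hx) at 2.
  rewrite <- Rpower_plus; f_equal; ring.
Qed.

Lemma is_derive_Rpower_comp (g : R -> R) (p x dg : R) :
  0 < g x -> is_derive g x dg ->
  is_derive (fun t => Rpower (g t) p) x (p * Rpower (g x) (p - 1) * dg).
Proof.
  intros hg dgx.
  replace (p * Rpower (g x) (p - 1) * dg)
    with (scal dg (p * Rpower (g x) (p - 1)))
    by (unfold scal; simpl; unfold mult; simpl; ring).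
  apply (is_derive_comp (fun t => Rpower t p)); [| exact dgx].
  apply is_derive_Reals, derivable_pt_lim_power, hg.
Qed.

(** Turns thresholds stated with a [p]-th root into inequalities between powers of loads. *)
Lemma Rpower_root_scale (m x y p : R) :
  0 < m -> 0 < x -> 0 < p ->
  Rpower m (1 / p) * x <= y -> m * Rpower x p <= Rpower y p.
Proof.
  intros hm hx hp h.
  replace (m * Rpower x p) with (Rpower (Rpower m (1 / p) * x) p).
  - apply Rle_Rpower_l; [lra |]; split; [| exact h].
    apply Rmult_lt_0_compat; [apply Rpower_gt0 | exact hx].
  - rewrite <- Rpower_mult_distr by (try apply Rpower_gt0; exact hx).
    rewrite Rpower_mult; replace (1 / p * p) with 1 by (field; lra).
    rewrite Rpower_1 by exact hm; reflexivity.
Qed.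

(** * Network loads, marginal costs and the derivative of [PHT] *)

Definition veh_load (S : scenario) (alpha beta : R) : R :=
  (x_pv S + (1 - beta) * x_rs S) / (omega S * alpha * Cap S).

Definition bus_load (S : scenario) (alpha beta : R) : R :=
  (beta * x_rs S / o_p S + f_b S) / ((1 - alpha) * Cap S).

(** In units of [t_f], the first summand is the travel time of one more pooling user; the second is
    the extra delay imposed on all poolers and bus users. The constant [gamma] disappears on
    differentiation. *)
Definition bus_marginal (S : scenario) (alpha beta : R) : R :=
  Delta_p S * k S * (1 + bpr_a S * Rpower (bus_load S alpha beta) (bpr_b S)) +
  (Delta_p S * (beta * x_rs S) + Delta_b S * x_b S) * k S * bpr_a S *
  bpr_b S / (o_p S * ((1 - alpha) * Cap S)) *
  Rpower (bus_load S alpha beta) (bpr_b S - 1).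

(** Own and imposed delays merge here: [n * (1 + a * (n / A)^b)] has derivative
    [1 + a * (b + 1) * (n / A)^b] in [n]. *)
Definition veh_marginal (S : scenario) (alpha beta : R) : R :=
  1 + bpr_a S * (bpr_b S + 1) * Rpower (veh_load S alpha beta) (bpr_b S).

Definition PHT_deriv (S : scenario) (alpha beta : R) : R :=
  x_rs S * t_f S * (bus_marginal S alpha beta - veh_marginal S alpha beta).

Ltac scenario_facts S :=
  pose proof (t_f_gt0 S); pose proof (Cap_gt0 S); pose proof (bpr_a_gt0 S);
  pose proof (bpr_b_gt0 S); pose proof (o_p_gt1 S);
  pose proof (Delta_p_gt1 S); pose proof (Delta_b_gt1 S);
  pose proof (x_pv_gt0 S); pose proof (x_rs_gt0 S); pose proof (x_b_gt0 S);
  pose proof (f_b_gt0 S); pose proof (f_b_lt_x_b S); pose proof (k_gt1 S);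
  assert (0 < omega S) by apply omega_range.

Ltac pos := repeat first
  [ assumption | lra | apply Rmult_lt_0_compat | apply Rinv_0_lt_compat
  | apply Rpower_gt0 ].

Lemma veh_load_gt0 (S : scenario) (alpha beta : R) :
  0 < alpha -> beta <= 1 -> 0 < veh_load S alpha beta.
Proof.
  intros ha hb; scenario_facts S; unfold veh_load.
  apply Rdiv_lt_0_compat; [nra | pos].
Qed.

Lemma pool_flow_gt0 (S : scenario) (beta : R) :
  0 <= beta -> 0 < beta * x_rs S / o_p S + f_b S.
Proof.
  intros hb; scenario_facts S.
  assert (0 <= beta * x_rs S / o_p S); [| lra].
  apply Rdiv_le_0_compat; [nra | lra].
Qed.

Lemma bus_load_gt0 (S : scenario) (alpha beta : R) :
  alpha < 1 -> 0 <= beta -> 0 < bus_load S alpha beta.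
Proof.
  intros ha hb; scenario_facts S; unfold bus_load.
  apply Rdiv_lt_0_compat; [apply pool_flow_gt0, hb | pos].
Qed.

Lemma PHT_derivE (S : scenario) (alpha beta : R) :
  0 < alpha < 1 -> 0 <= beta <= 1 ->
  derivable_pt_lim (PHT S alpha) beta (PHT_deriv S alpha beta).
Proof.
  intros ha hbe; scenario_facts S.
  pose proof (veh_load_gt0 S alpha beta ltac:(lra) ltac:(lra)) as hv.
  pose proof (bus_load_gt0 S alpha beta ltac:(lra) ltac:(lra)) as hu.
  assert (hA : omega S * alpha * Cap S <> 0) by (apply Rgt_not_eq; pos).
  assert (hB : (1 - alpha) * Cap S <> 0) by (apply Rgt_not_eq; pos).
  apply is_derive_Reals.
  assert (dv : is_derive (fun t => Rpower (veh_load S alpha t) (bpr_b S)) beta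
    (bpr_b S * Rpower (veh_load S alpha beta) (bpr_b S - 1) *
     (- x_rs S / (omega S * alpha * Cap S)))).
  { apply is_derive_Rpower_comp; [exact hv |].
    unfold veh_load; auto_derive; [exact I | field; lra]. }
  assert (du : is_derive (fun t => Rpower (bus_load S alpha t) (bpr_b S)) beta
    (bpr_b S * Rpower (bus_load S alpha beta) (bpr_b S - 1) *
     (x_rs S / (o_p S * ((1 - alpha) * Cap S))))).
  { apply is_derive_Rpower_comp; [exact hu |].
    unfold bus_load; auto_derive; [exact I | field; lra]. }
  (* With both powers opaque, [auto_derive] leaves their derivatives to [dv] and [du]. *)
  set (V := fun t => Rpower (veh_load S alpha t) (bpr_b S)) in *.
  set (U := fun t => Rpower (bus_load S alpha t) (bpr_b S)) in *.
  apply (is_derive_ext (fun t =>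
    (x_pv S + (1 - t) * x_rs S) * (t_f S * (1 + bpr_a S * V t)) +
    (t * x_rs S * Delta_p S + x_b S * Delta_b S) * k S *
      (t_f S * (1 + bpr_a S * U t)) + x_b S * gamma S)).
  { intros t; unfold PHT, t_V, t_B, t_b, V, U, veh_load, bus_load.
    (* The equation is typed in the carrier of a normed module; [ring] needs it over [R]. *)
    match goal with |- ?l = ?r => change (@eq R l r) end; ring. }
  auto_derive.
  { repeat split; eexists; eassumption. }
  rewrite (is_derive_unique (fun x : R => V x) beta _ dv).
  rewrite (is_derive_unique (fun x : R => U x) beta _ du).
  unfold PHT_deriv, bus_marginal, veh_marginal, V, U.
  rewrite (Rpower_pred (veh_load S alpha beta)) by exact hv.
  set (P := Rpower (veh_load _ _ _) (_ - 1)).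
  set (Q := Rpower (bus_load _ _ _) (_ - 1)).
  set (W := Rpower (bus_load _ _ _) _).
  unfold veh_load.
  field; repeat split; try lra; apply Rgt_not_eq; pos.
Qed.

(** Pooling more shifts load from vehicles to buses. Strictness comes from the vehicle side;
    [1 < bpr_b S] makes the power with exponent [bpr_b S - 1] monotone on the bus side. *)
Lemma PHT_deriv_incr (S : scenario) (alpha x y : R) :
  1 < bpr_b S -> 0 < alpha < 1 -> 0 <= x -> x < y -> y <= 1 ->
  PHT_deriv S alpha x < PHT_deriv S alpha y.
Proof.
  intros hb ha hx hxy hy; scenario_facts S.
  pose proof (veh_load_gt0 S alpha y ltac:(lra) ltac:(lra)) as hv.
  pose proof (bus_load_gt0 S alpha x ltac:(lra) ltac:(lra)) as hu.
  assert (lv : veh_load S alpha y < veh_load S alpha x).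
  { unfold veh_load; apply Rmult_lt_compat_r; [pos |].
    nra. }
  assert (lu : bus_load S alpha x <= bus_load S alpha y).
  { unfold bus_load; apply Rmult_le_compat_r;
      [left; pos |].
    apply Rplus_le_compat_r, Rmult_le_compat_r;
      [left; pos | nra]. }
  assert (pv := Rlt_Rpower_l _ _ (bpr_b S) ltac:(lra) (conj hv lv)).
  assert (pu := Rle_Rpower_l _ _ (bpr_b S) ltac:(lra) (conj hu lu)).
  assert (pu1 := Rle_Rpower_l _ _ (bpr_b S - 1) ltac:(lra) (conj hu lu)).
  unfold PHT_deriv; apply Rmult_lt_compat_l; [pos |].
  apply Rplus_le_lt_compat.
  - assert (hxs : 0 <= x * x_rs S) by nra.
    assert (hn : 0 < Delta_p S * (x * x_rs S) + Delta_b S * x_b S) by nra.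
    unfold bus_marginal; apply Rplus_le_compat.
    + apply Rmult_le_compat_l; [left; pos |]; nra.
    + apply Rmult_le_compat; [| left; apply Rpower_gt0 | | exact pu1].
      * left; pos.
      * apply Rmult_le_compat_r; [left; pos |].
        repeat (apply Rmult_le_compat_r; [lra |]).
        apply Rplus_le_compat_r, Rmult_le_compat_l; nra.
  - apply Ropp_lt_contravar; unfold veh_marginal.
    apply Rplus_lt_compat_l, Rmult_lt_compat_l; [pos | exact pv].
Qed.

(** * Sign of the derivative at the endpoints *)

Lemma PHT_deriv_gt0 (S : scenario) (alpha beta : R) :
  0 < alpha < 1 -> 0 <= beta <= 1 ->
  Rpower ((bpr_b S + 1) / (bpr_b S / o_p S + 1)) (1 / bpr_b S) *
    (x_pv S + (1 - beta) * x_rs S) <=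
    omega S * (alpha / (1 - alpha)) * (beta * x_rs S / o_p S + f_b S) ->
  0 < PHT_deriv S alpha beta.
Proof.
  intros ha hbe h; scenario_facts S.
  pose proof (veh_load_gt0 S alpha beta ltac:(lra) ltac:(lra)) as hv.
  pose proof (bus_load_gt0 S alpha beta ltac:(lra) ltac:(lra)) as hu.
  assert (hbo : 0 < bpr_b S / o_p S) by pos.
  assert (hm : 0 < (bpr_b S + 1) / (bpr_b S / o_p S + 1)) by pos.
  assert (hB : 0 < (1 - alpha) * Cap S) by pos.
  set (m := (bpr_b S + 1) / (bpr_b S / o_p S + 1)) in *.
  assert (hl : Rpower m (1 / bpr_b S) * veh_load S alpha beta <=
    bus_load S alpha beta).
  (* Up to the common factor [omega S * alpha * Cap S], this is the hypothesis [h]. *)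
  { unfold veh_load, bus_load.
    apply Rmult_le_reg_r with (omega S * alpha * Cap S); [pos |].
    eapply Rle_trans; [| eapply Rle_trans; [exact h |]]; right.
    - field; repeat split; lra.
    - field; repeat split; lra. }
  apply Rpower_root_scale in hl; try assumption.
  set (u := bus_load S alpha beta) in *.
  set (v := veh_load S alpha beta) in *.
  assert (hl' : (bpr_b S + 1) * Rpower v (bpr_b S) <=
    (bpr_b S / o_p S + 1) * Rpower u (bpr_b S)).
  { replace (bpr_b S + 1) with ((bpr_b S / o_p S + 1) * m)
      by (unfold m; field; lra).
    rewrite Rmult_assoc; apply Rmult_le_compat_l; [lra | exact hl]. }
  (* Dropping the occupancy and replacing [f_b] by [x_b] relates the load to the number of
     travellers delayed on the bus network. *)
  assert (hs : u <= (beta * x_rs S + x_b S) / ((1 - alpha) * Cap S)).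
  { unfold u, bus_load; apply Rmult_le_compat_r;
      [left; apply Rinv_0_lt_compat, hB |].
    apply Rplus_le_compat; [| lra].
    apply Rmult_le_reg_r with (o_p S); [lra |].
    replace (beta * x_rs S / o_p S * o_p S) with (beta * x_rs S)
      by (field; lra).
    assert (0 <= beta * x_rs S) by nra; nra. }
  pose proof (Rpower_gt0 u (bpr_b S)) as hU.
  pose proof (Rpower_gt0 u (bpr_b S - 1)) as hU1.
  pose proof (Rpower_pred u (bpr_b S) hu) as eU.
  unfold PHT_deriv; apply Rmult_lt_0_compat; [pos |].
  unfold bus_marginal, veh_marginal; fold u v.
  assert (hDk : 1 < Delta_p S * k S) by nra.
  assert (h1 : 1 + bpr_a S * Rpower u (bpr_b S) <
    Delta_p S * k S * (1 + bpr_a S * Rpower u (bpr_b S))).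
  { assert (0 < bpr_a S * Rpower u (bpr_b S)) by pos; nra. }
  (* The imposed delay supplies the [bpr_b S / o_p S] part of the threshold, and [h1] supplies the 1
     together with strictness. *)
  assert (h2 : bpr_a S * (bpr_b S / o_p S * Rpower u (bpr_b S)) <=
    (Delta_p S * (beta * x_rs S) + Delta_b S * x_b S) * k S * bpr_a S *
    bpr_b S / (o_p S * ((1 - alpha) * Cap S)) * Rpower u (bpr_b S - 1)).
  { rewrite eU.
    apply Rle_trans with (bpr_a S * (bpr_b S / o_p S *
      ((beta * x_rs S + x_b S) / ((1 - alpha) * Cap S) *
       Rpower u (bpr_b S - 1)))).
    - repeat (apply Rmult_le_compat_l; [lra |]).
      apply Rmult_le_compat_r; lra.
    - set (E := bpr_a S * bpr_b S / (o_p S * ((1 - alpha) * Cap S)) *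
        Rpower u (bpr_b S - 1)).
      apply Rle_trans with ((beta * x_rs S + x_b S) * E);
        [right; unfold E; field; lra |].
      apply Rle_trans with
        ((Delta_p S * (beta * x_rs S) + Delta_b S * x_b S) * k S * E);
        [| right; unfold E; field; lra].
      apply Rmult_le_compat_r; [left; unfold E; pos |].
      assert (hz : 0 <= beta * x_rs S) by nra.
      revert hz; generalize (beta * x_rs S); intros z hz.
      assert (z + x_b S <= Delta_p S * z + Delta_b S * x_b S) by nra.
      assert (0 < z + x_b S) by lra; nra. }
  assert (h3 := Rmult_le_compat_l (bpr_a S) _ _ ltac:(lra) hl').
  lra.
Qed.

(** The bus side depends on [alpha] through [1 / (1 - alpha)], so its value at [1 / 2] bounds it
    uniformly for small [alpha]. *)
Lemma bus_marginal_half_capacity (S : scenario) (alpha : R) :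
  1 < bpr_b S -> alpha <= 1 / 2 ->
  bus_marginal S alpha 1 <= bus_marginal S (1 / 2) 1.
Proof.
  intros hb ha; scenario_facts S.
  pose proof (bus_load_gt0 S alpha 1 ltac:(lra) ltac:(lra)) as hu.
  assert (hi : forall c, 0 < c ->
    / (c * ((1 - alpha) * Cap S)) <= / (c * ((1 - 1 / 2) * Cap S))).
  { intros c hc; apply Rinv_le_contravar; [pos |].
    apply Rmult_le_compat_l; [lra |]; apply Rmult_le_compat_r; lra. }
  assert (lu : bus_load S alpha 1 <= bus_load S (1 / 2) 1).
  { unfold bus_load; apply Rmult_le_compat_l.
    - left; apply pool_flow_gt0; lra.
    - specialize (hi 1 ltac:(lra)); rewrite !Rmult_1_l in hi; exact hi. }
  unfold bus_marginal; apply Rplus_le_compat.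
  - apply Rmult_le_compat_l; [left; pos |].
    apply Rplus_le_compat_l, Rmult_le_compat_l; [lra |].
    apply Rle_Rpower_l; lra.
  - assert (0 < Delta_p S * (1 * x_rs S) + Delta_b S * x_b S) by nra.
    apply Rmult_le_compat; [left; pos | left; pos | |].
    + apply Rmult_le_compat_l; [left; pos | apply hi; lra].
    + apply Rle_Rpower_l; lra.
Qed.

Lemma PHT_deriv_small_alpha (S : scenario) :
  1 < bpr_b S ->
  exists alpha_low, 0 < alpha_low /\
    forall alpha, 0 < alpha < 1 -> alpha < alpha_low ->
      PHT_deriv S alpha 1 <= 0.
Proof.
  intros hb; scenario_facts S.
  (* Once the [bpr_b S]-th power of the vehicle load reaches [M], the vehicle marginal cost exceeds
     the uniform bus bound. *)
  set (M := bus_marginal S (1 / 2) 1 / (bpr_a S * (bpr_b S + 1))).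
  assert (hM : 0 < M).
  { unfold M; apply Rdiv_lt_0_compat; [| pos].
    assert (0 < Delta_p S * (1 * x_rs S) + Delta_b S * x_b S) by nra.
    unfold bus_marginal; apply Rplus_lt_0_compat; [| pos].
    apply Rmult_lt_0_compat; [pos |].
    apply Rplus_lt_0_compat; pos. }
  set (r := Rpower M (1 / bpr_b S)).
  assert (hr : 0 < r) by apply Rpower_gt0.
  (* The second entry is the split at which [veh_load S alpha 1] equals [r]. *)
  exists (Rmin (1 / 2) (x_pv S / (omega S * Cap S * r))); split.
  { apply Rmin_pos; pos. }
  intros alpha ha hlow.
  pose proof (Rmin_l (1 / 2) (x_pv S / (omega S * Cap S * r))) as m1.
  pose proof (Rmin_r (1 / 2) (x_pv S / (omega S * Cap S * r))) as m2.
  (* The factor 1 matches [Rpower_root_scale] taken with [x = 1]. *)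
  assert (hv : r * 1 <= veh_load S alpha 1).
  { unfold veh_load.
    apply Rmult_le_reg_r with (omega S * alpha * Cap S); [pos |].
    replace ((x_pv S + (1 - 1) * x_rs S) / (omega S * alpha * Cap S) *
      (omega S * alpha * Cap S)) with
      (x_pv S / (omega S * Cap S * r) * (omega S * Cap S * r))
      by (field; repeat split; lra).
    replace (r * 1 * (omega S * alpha * Cap S)) with
      (alpha * (omega S * Cap S * r)) by ring.
    apply Rmult_le_compat_r; [left; pos | lra]. }
  apply Rpower_root_scale in hv; try lra.
  replace (Rpower 1 (bpr_b S)) with 1 in hv
    by (unfold Rpower; rewrite ln_1, Rmult_0_r, exp_0; reflexivity).
  pose proof (bus_marginal_half_capacity S alpha hb ltac:(lra)) as hh.
  assert (eM : bus_marginal S (1 / 2) 1 = bpr_a S * (bpr_b S + 1) * (M * 1))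
    by (unfold M; field; lra).
  assert (hp : 0 < bpr_a S * (bpr_b S + 1)) by pos.
  apply (Rmult_le_compat_l _ _ _ (Rlt_le _ _ hp)) in hv.
  assert (ht : 0 < x_rs S * t_f S) by pos.
  unfold PHT_deriv, veh_marginal; nra.
Qed.

Theorem proposition3 (S : scenario) (hb : 1 < bpr_b S) :
  (forall alpha, 0 < alpha < 1 ->
     exists betaSO, unique (system_optimum S alpha) betaSO /\
       (omega S * (alpha / (1 - alpha)) * (x_rs S / o_p S + f_b S) >
          Rpower ((bpr_b S + 1) / (bpr_b S / o_p S + 1)) (1 / bpr_b S) * x_pv S ->
        betaSO < 1) /\
       (omega S * (alpha / (1 - alpha)) * f_b S >=
          Rpower ((bpr_b S + 1) / (bpr_b S / o_p S + 1)) (1 / bpr_b S) *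
          (x_pv S + x_rs S) ->
        betaSO = 0)) /\
  (exists alpha_low, 0 < alpha_low /\
     forall alpha, 0 < alpha < 1 -> alpha < alpha_low ->
       forall betaSO, system_optimum S alpha betaSO -> betaSO = 1).
Proof.
  assert (D : forall alpha, 0 < alpha < 1 -> forall x, 0 <= x <= 1 ->
    derivable_pt_lim (PHT S alpha) x (PHT_deriv S alpha x))
    by (intros; apply PHT_derivE; assumption).
  assert (I : forall alpha, 0 < alpha < 1 -> forall x y,
    0 <= x -> x < y -> y <= 1 -> PHT_deriv S alpha x < PHT_deriv S alpha y)
    by (intros; apply PHT_deriv_incr; assumption).
  split.
  - intros alpha ha.
    destruct (deriv_minimizer_exists _ _ (D alpha ha)) as [x [hx mx]].
    exists x; repeat split; try lra; try exact mx.
    + intros y [hy my].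
      exact (incr_deriv_minimizer_unique _ _ (D alpha ha) (I alpha ha)
        x y hx hy mx my).
    + intros h.
      refine (pos_deriv_not_min_at_1 _ _ (D alpha ha) x _ hx mx).
      apply PHT_deriv_gt0; [exact ha | lra |].
      replace (x_pv S + (1 - 1) * x_rs S) with (x_pv S) by ring.
      rewrite Rmult_1_l; lra.
    + intros h.
      refine (incr_deriv_min_at_0 _ _ (D alpha ha) (I alpha ha) x _ hx mx).
      (* Even the weak threshold gives a strictly positive derivative at 0. *)
      left; apply PHT_deriv_gt0; [exact ha | lra |].
      replace (x_pv S + (1 - 0) * x_rs S) with (x_pv S + x_rs S) by ring.
      replace (0 * x_rs S / o_p S + f_b S) with (f_b S)
        by (unfold Rdiv; ring).
      lra.
  - destruct (PHT_deriv_small_alpha S hb) as [al [hal H]].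
    exists al; split; [exact hal |].
    intros alpha ha hlow x [hx mx].
    exact (incr_deriv_min_at_1 _ _ (D alpha ha) (I alpha ha) x
      (H alpha ha hlow) hx mx).
Qed.
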